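(* Let $G$ be a simple graph on the vertex set $[n]=\{1,\dots,n\}$, let $S=k[x_1,\dots,x_n,y_1,\dots,y_n]$ and let $J_G\subset S$ be the binomial edge ideal of $G$. The quadratic dual of the algebra $S/J_G$ is $$k\langle x_1,\ldots,x_n,y_1,\ldots,y_n\rangle/J_G^\perp,$$ where $J_G^\perp$ is the two-sided ideal generated by the relations $$x_i^2=0,\quad y_i^2=0,\qquad 1\leq i\leq n,$$ $$x_ix_j+x_jx_i=0,\quad y_iy_j+y_jy_i=0,\qquad 1\leq j<i\leq n,$$ $$x_iy_j+y_jx_i=0,\qquad i,j\in[n],\ \{i,j\}\notin E(G)\ \text{(including the case } i=j),$$ $$x_iy_j+y_jx_i+x_jy_i+y_ix_j=0,\qquad \{i,j\}\in E(G).$$ Here, in the dual algebra, $x_1,\dots,x_n,y_1,\dots,y_n$ denote the dual basis of the basis of variables of $S$.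
   Context: $k$ is a field of characteristic zero; graphs are undirected and simple (no loops or multiple edges). Binomial edge ideal: $J_G=\langle f_{ij}=x_iy_j-x_jy_i : \{i,j\}\in E(G)\rangle\subset S$. Quadratic dual: let $V$ be a finite-dimensional $k$-vector space with tensor algebra $T(V)$ (choosing a basis of $V$ identifies $T(V)$ with the free associative algebra on that basis). Let $I\subset V\otimes V$ be a subspace and $R=T(V)/\langle I\rangle$ the quadratic algebra it defines, where $\langle I\rangle$ is the two-sided ideal generated by $I$. Put $I^\perp=\{\phi\in V^*\otimes V^*\cong (V\otimes V)^* : \phi(I)=0\}$, using the standard identification $(\phi\otimes\psi)(u\otimes w)=\phi(u)\psi(w)$. The quadratic dual of $R$ is $T(V^* )/\langle I^\perp\rangle$. The commutative algebra $S/J_G$ is regarded as a quadratic algebra $T(V)/\langle I\rangle$ with $V$ the $2n$-dimensional space with basis $x_1,\dots,x_n,y_1,\dots,y_n$ and $I\subset V\otimes V$ spanned by all commutators of basis elements together with the elements $x_i\otimes y_j-x_j\otimes y_i$ for $\{i,j\}\in E(G)$. The notation $J_G^\perp$ in the claim stands for the ideal $\langle I^\perp\rangle$ of $T(V^* )=k\langle x_1,\dots,x_n,y_1,\dots,y_n\rangle$ for this $I$. *)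

(* Defs.v *)
From HB Require Import structures.
From mathcomp Require Import all_boot all_order all_algebra.
From mathcomp Require Import finmap.
From mathcomp.multinomials Require Import monalg.

Set Implicit Arguments.
Unset Strict Implicit.
Unset Printing Implicit Defensive.

Import GRing.Theory.
Local Open Scope ring_scope.

(* The two-sided ideal generated by [P]. *)
Inductive ideal_gen (A : pzRingType) (P : A -> Prop) : A -> Prop :=
| ideal_gen_in f : P f -> ideal_gen P f
| ideal_gen0 : ideal_gen P 0
| ideal_genD f g : ideal_gen P f -> ideal_gen P g -> ideal_gen P (f + g)
| ideal_genMl a f : ideal_gen P f -> ideal_gen P (a * f)
| ideal_genMr a f : ideal_gen P f -> ideal_gen P (f * a).

(* The polynomial ring and the free associative algebra over [k] whose
   variables are the elements of [X]. *)
Notation polyalg k X := {malg k[{cmonom X}]}.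
Notation freealg k X := {malg k[{fmonom X}]}.

Definition pvar (k : fieldType) (X : finType) (x : X) : polyalg k X :=
  << ucm x >>.
Definition fvar (k : fieldType) (X : finType) (x : X) : freealg k X :=
  << fmu x >>.

(* [V] is a vector space with basis indexed by [X], an element of [V] being
   the family of its coordinates.  Then [V (x) V] has basis indexed by
   [X * X], and T(V) is [freealg k X], the variable [x] standing for the basis
   vector [x].  The dual [V^*] is the space of linear forms; with respect to
   the dual basis, [V^* (x) V^*] is again [tens2 k X] and T(V^* ) is again
   [freealg k X], the variable [x] now standing for the dual basis vector. *)
Notation vec k X := {ffun X -> k^o}.
Notation dual k X := 'Hom(vec k X, k^o).
Notation tens2 k X := {ffun X * X -> k^o}.

Section Quadratic.
Variables (k : fieldType) (X : finType).

Definition basis_vec (x : X) : vec k X := [ffun y => (y == x)%:R].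

Definition dual_coord (phi : dual k X) : vec k X :=
  [ffun x => phi (basis_vec x)].

Definition tens (u w : vec k X) : tens2 k X := [ffun p => u p.1 * w p.2].

(* The inclusion of the degree 2 component into the tensor algebra. *)
Definition tens_alg (t : tens2 k X) : freealg k X :=
  \sum_p t p *: (fvar k p.1 * fvar k p.2).

(* The identification of [V^* (x) V^*] with the dual of [V (x) V]: it is the
   bilinear pairing with (phi (x) psi)(u (x) w) = phi(u) psi(w), as shown by
   [pairing_tens]. *)
Definition pairing (Phi t : tens2 k X) : k := \sum_p Phi p * t p.

Definition orth (I : {vspace tens2 k X}) (Phi : tens2 k X) : Prop :=
  forall t, t \in I -> pairing Phi t = 0.

Definition quad_ideal (R : tens2 k X -> Prop) : freealg k X -> Prop :=
  ideal_gen (fun f => exists2 t, R t & f = tens_alg t).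

(* The identification of S / J with the quadratic algebra T(V) / <I>: a
   morphism from T(V) to S that is onto modulo [J] and under which the
   preimage of [J] is <I>. *)
Record quadratic_presentation (S : lalgType k) (J : S -> Prop) := QuadPres {
  qp_rel : {vspace tens2 k X};
  qp_map : {lrmorphism freealg k X -> S};
  qp_onto : forall s, exists f, J (s - qp_map f);
  qp_kernel : forall f, J (qp_map f) <-> quad_ideal (fun t => t \in qp_rel) f
}.

(* The ideal <I^perp> of T(V^* ) whose quotient is the quadratic dual. *)
Definition quadratic_dual_ideal (S : lalgType k) (J : S -> Prop)
    (P : quadratic_presentation J) : freealg k X -> Prop :=
  quad_ideal (orth (qp_rel P)).

Lemma vec_expand (u : vec k X) : u = \sum_x u x *: basis_vec x.
Proof.
apply/ffunP=> y; rewrite sum_ffunE (bigD1 y) //= big1 => [|x xy].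
  by rewrite !ffunE eqxx addr0; exact: esym (mulr1 _).
by rewrite !ffunE eq_sym (negPf xy); exact: mulr0.
Qed.

Lemma dual_coordE (phi : dual k X) u : phi u = \sum_x dual_coord phi x * u x.
Proof.
rewrite [u in LHS]vec_expand linear_sum; apply: eq_bigr => x _.
by rewrite linearZ ffunE mulrC.
Qed.

Lemma pairing_tens (phi psi : dual k X) (u w : vec k X) :
  pairing (tens (dual_coord phi) (dual_coord psi)) (tens u w) = phi u * psi w.
Proof.
rewrite /pairing !dual_coordE big_distrlr /= pair_bigA /=.
by apply: eq_bigr => p _; rewrite !ffunE mulrACA.
Qed.

End Quadratic.

(* [inl i] is the variable x_i and [inr i] is the variable y_i. *)
Notation xyvar n := ('I_n + 'I_n)%type.

Section BinomialEdge.
Variables (k : fieldType) (n : nat) (E : rel 'I_n).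

Local Notation x i := (inl i : xyvar n).
Local Notation y i := (inr i : xyvar n).

Variant edge_binomial : polyalg k (xyvar n) -> Prop :=
| Edge_binomial i j of E i j :
    edge_binomial (pvar k (x i) * pvar k (y j) - pvar k (x j) * pvar k (y i)).

Definition binomial_edge_ideal : polyalg k (xyvar n) -> Prop :=
  ideal_gen edge_binomial.

Definition commutators : seq (tens2 k (xyvar n)) :=
  [seq tens (basis_vec k p.1) (basis_vec k p.2)
       - tens (basis_vec k p.2) (basis_vec k p.1) | p : xyvar n * xyvar n].

Definition edge_tensors : seq (tens2 k (xyvar n)) :=
  [seq tens (basis_vec k (x p.1)) (basis_vec k (y p.2))
       - tens (basis_vec k (x p.2)) (basis_vec k (y p.1))
  | p : 'I_n * 'I_n in [pred p | E p.1 p.2]].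

Definition binomial_edge_relations : {vspace tens2 k (xyvar n)} :=
  <<commutators ++ edge_tensors>>%VS.

Variant dual_relation : freealg k (xyvar n) -> Prop :=
| Dual_xx i : dual_relation (fvar k (x i) ^+ 2)
| Dual_yy i : dual_relation (fvar k (y i) ^+ 2)
| Dual_xxC (i j : 'I_n) of (j < i)%N :
    dual_relation (fvar k (x i) * fvar k (x j) + fvar k (x j) * fvar k (x i))
| Dual_yyC (i j : 'I_n) of (j < i)%N :
    dual_relation (fvar k (y i) * fvar k (y j) + fvar k (y j) * fvar k (y i))
| Dual_nonedge i j of ~~ E i j :
    dual_relation (fvar k (x i) * fvar k (y j) + fvar k (y j) * fvar k (x i))
| Dual_edge i j of E i j :
    dual_relation (fvar k (x i) * fvar k (y j) + fvar k (y j) * fvar k (x i)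
                 + fvar k (x j) * fvar k (y i) + fvar k (y i) * fvar k (x j)).

End BinomialEdge.

(* The canonical morphism from the free algebra to the polynomial ring. *)
Definition cword (X : finType) (m : {fmonom X}) : {cmonom X} :=
  \big[mmul/mone]_(x <- (m : seq X)) ucm x.
Definition commz (k : fieldType) (X : finType) :
    freealg k X -> polyalg k X :=
  mmap (@malgC {cmonom X} k) (fun m => << cword m >>).

Section Commz.
Variables (k : fieldType) (X : finType).

Let word (m : {fmonom X}) : polyalg k X := << cword m >>.

Lemma malgUM (K : monomType) (a b : K) :
  << mmul a b >> = << a >> * << b >> :> {malg k[K]}.
Proof. by rewrite malgM_def fgmulUU mulr1. Qed.

Lemma malgUZ (K : monomType) c (m : K) :
  << c *g m >> = c *: << m >> :> {malg k[K]}.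
Proof. by apply/malgP=> m'; rewrite mcoeffZ !mcoeffU mulr_natr. Qed.

Fact word_mmorphism : mmorphism word.
Proof.
split=> [m1 m2|]; last by rewrite /word /cword fm1 big_nil.
by rewrite /word /cword fmM big_cat malgUM.
Qed.
HB.instance Definition _ := isMultiplicative.Build _ _ word word_mmorphism.

HB.instance Definition _ :=
  GRing.RMorphism.copy (@commz k X) (mmap (@malgC {cmonom X} k) word).

Fact commz_scalable : scalable (@commz k X).
Proof. by move=> c g; rewrite /commz (mmapZ (h := word)) mul_malgC. Qed.
HB.instance Definition _ :=
  GRing.isScalable.Build k (freealg k X) (polyalg k X) *:%R (@commz k X)
    commz_scalable.

Lemma commz_var (x : X) : commz (fvar k x) = pvar k x.
Proof.
by rewrite /commz /fvar mmapU mul_malgC scale1r /cword fmU big_seq1.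
Qed.

Lemma freealg_ind (P : freealg k X -> Prop) :
  P 0 -> P 1 -> (forall f g, P f -> P g -> P (f + g)) ->
  (forall c f, P f -> P (c *: f)) -> (forall (x : X) f, P f -> P (fvar k x * f)) ->
  forall f, P f.
Proof.
move=> P0 P1 PD PZ PM f; rewrite [f]monalgE.
apply: big_ind => // m _.
rewrite malgUZ; apply: PZ; case: m => s; elim: s => [|x s IHs].
  by rewrite -fmoneE.
have -> : FMonom (x :: s) = mmul (fmu x) (FMonom s) :> {fmonom X}.
  by apply/val_inj; rewrite /= fmM fmU.
by rewrite malgUM; apply: PM.
Qed.

End Commz.

Section IdealCongruence.
Variables (A : pzRingType) (P : A -> Prop).
Local Notation I := (ideal_gen P).
Local Notation "f ~ g" := (I (f - g)) (at level 70).

Lemma ideal_genN f : I f -> I (- f).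
Proof. by move=> If; rewrite -mulN1r; apply: ideal_genMl. Qed.

Lemma eqm_refl f : f ~ f.
Proof. by rewrite subrr; apply: ideal_gen0. Qed.

Lemma eqm_sym f g : f ~ g -> g ~ f.
Proof. by move/ideal_genN; rewrite opprB. Qed.

Lemma eqm_trans g f h : f ~ g -> g ~ h -> f ~ h.
Proof. by move=> fg /(ideal_genD fg); rewrite addrA subrK. Qed.

Lemma eqmD f f' g g' : f ~ f' -> g ~ g' -> f + g ~ f' + g'.
Proof. by move=> ff' gg'; rewrite opprD addrACA; apply: ideal_genD. Qed.

Lemma eqmMl a f g : f ~ g -> a * f ~ a * g.
Proof. by move=> fg; rewrite -mulrBr; apply: ideal_genMl. Qed.

Lemma eqmMr a f g : f ~ g -> f * a ~ g * a.
Proof. by move=> fg; rewrite -mulrBl; apply: ideal_genMr. Qed.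

Lemma eqm_commM a b c : a * c ~ c * a -> b * c ~ c * b ->
  (a * b) * c ~ c * (a * b).
Proof.
move=> /(eqmMr b) h1 /(eqmMl a) h2; rewrite !mulrA in h1 h2 *.
exact: eqm_trans h2 h1.
Qed.

Lemma eqm_mulACA a b u v p : b * u ~ u * b -> p ~ u * v ->
  (a * b) * p ~ (a * u) * (b * v).
Proof.
move=> /(eqmMl a) /(eqmMr v) h1 /(eqmMl (a * b)) h2.
rewrite !mulrA in h1 h2 *; exact: eqm_trans h2 h1.
Qed.

Lemma eqm_sum (T : Type) (r : seq T) (F G : T -> A) :
  (forall t, F t ~ G t) -> \sum_(t <- r) F t ~ \sum_(t <- r) G t.
Proof.
move=> FG; elim: r => [|t r IHr]; first by rewrite !big_nil; apply: eqm_refl.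
by rewrite !big_cons; apply: eqmD.
Qed.

Lemma eqm_ideal f g : f ~ g -> I g -> I f.
Proof. by move=> fg /(ideal_genD fg); rewrite subrK. Qed.

End IdealCongruence.

Section Kernel.
Variables (k : fieldType) (X : finType) (P : freealg k X -> Prop).
Local Notation I := (ideal_gen P).
Local Notation "f ~ g" := (I (f - g)) (at level 70).

Hypothesis var_comm : forall x y : X, fvar k x * fvar k y ~ fvar k y * fvar k x.

Let scale_malg (c : k) (f g : freealg k X) : f * (c *: g) = c *: (f * g).
Proof.
have comC : f * c%:MP = c%:MP * f.
  rewrite [f in LHS]monalgE [f in RHS]monalgE mulr_suml mulr_sumr.
  apply: eq_bigr => m _.
  by rewrite !malgM_def !fgmulUU mul1m mulm1 mulrC.
by rewrite -(mul_malgC c g) (mulrA f) comC -(mulrA _ f g) mul_malgC.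
Qed.

Lemma eqmZ c (f g : freealg k X) : f ~ g -> c *: f ~ c *: g.
Proof. by rewrite -!mul_malgC; exact: eqmMl. Qed.

Lemma eqm_commute f g : f * g ~ g * f.
Proof.
elim/freealg_ind: f => [||f1 f2 h1 h2|c f h|x f h].
- by rewrite mul0r mulr0; apply: eqm_refl.
- by rewrite mul1r mulr1; apply: eqm_refl.
- by rewrite mulrDl mulrDr; exact: (eqmD h1 h2).
- by rewrite -scalerAl scale_malg; exact: eqmZ.
have x_comm : fvar k x * g ~ g * fvar k x.
  elim/freealg_ind: {f h} g => [||f1 f2 h1 h2|c f h|y f h].
  - by rewrite mul0r mulr0; apply: eqm_refl.
  - by rewrite mul1r mulr1; apply: eqm_refl.
  - by rewrite mulrDl mulrDr; exact: (eqmD h1 h2).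
  - by rewrite -scalerAl scale_malg; exact: eqmZ.
  - by apply: eqm_sym; apply: eqm_commM; [exact: var_comm|exact: eqm_sym].
exact: eqm_commM.
Qed.

Let mono (m : {cmonom X}) : freealg k X := \prod_(x : X) fvar k x ^+ m x.
Let sec : polyalg k X -> freealg k X := mmap (@malgC {fmonom X} k) mono.

Let mono1 : mono mone = 1.
Proof. by rewrite /mono big1 // => x _; rewrite cm1 expr0. Qed.

Let monoM m1 m2 : mono (mmul m1 m2) ~ mono m1 * mono m2.
Proof.
rewrite /mono; elim: (index_enum X) => [|x r IHr].
  by rewrite !big_nil mulr1; apply: eqm_refl.
rewrite !big_cons cmM exprD.
exact: (eqm_mulACA _ (eqm_commute _ _) IHr).
Qed.

Let secU c m : sec << c *g m >> = c *: mono m.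
Proof. by rewrite /sec mmapU mul_malgC. Qed.

Let secC c : sec c%:MP = c%:MP.
Proof.
apply: etrans (secU c mone) _.
exact: etrans (congr1 (fun f => c *: f) mono1) (esym (malgUZ c mone)).
Qed.

Let sec_var (x : X) : sec (pvar k x) = fvar k x.
Proof.
rewrite secU scale1r /mono; under eq_bigr do rewrite cmU.
rewrite (eq_bigr (fun y => if y == x then fvar k y else 1)) => [|y _].
  by rewrite -big_mkcond big_pred1_eq.
by rewrite eq_sym; case: eqP.
Qed.

Let sec_sum (T : Type) (r : seq T) (F : T -> polyalg k X) :
  sec (\sum_(t <- r) F t) = \sum_(t <- r) sec (F t).
Proof. exact: raddf_sum. Qed.

Let sec0 : sec 0 = 0.
Proof. exact: raddf0. Qed.

Let secD p q : sec (p + q) = sec p + sec q.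
Proof. exact: raddfD. Qed.

Let secE p : sec p = \sum_(m <- msupp p) p@_m *: mono m.
Proof. by rewrite /sec mmapE; apply: eq_bigr => m _; rewrite mul_malgC. Qed.

Let secM p q : sec (p * q) ~ sec p * sec q.
Proof.
rewrite malgME sec_sum (secE p) mulr_suml.
apply: eqm_sum => m1; rewrite sec_sum (secE q) mulr_sumr.
apply: eqm_sum => m2; rewrite secU -scalerAl scale_malg scalerA.
exact/eqmZ/monoM.
Qed.

Let secZ c p : sec (c *: p) ~ c *: sec p.
Proof.
by rewrite -!mul_malgC; apply: (eqm_trans (secM _ _)); rewrite secC; apply: eqm_refl.
Qed.

Let secK f : sec (commz f) ~ f.
Proof.
elim/freealg_ind: f => [||f1 f2 h1 h2|c f h|x f h].
- by rewrite (raddf0 (@commz k X)) sec0; exact: eqm_refl.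
- by rewrite (rmorph1 (@commz k X)) secC; exact: eqm_refl.
- by rewrite (raddfD (@commz k X)) secD; exact: (eqmD h1 h2).
- by rewrite linearZ; exact: (eqm_trans (secZ _ _) (eqmZ _ h)).
rewrite (rmorphM (@commz k X)) /= commz_var; apply: (eqm_trans (secM _ _)).
by rewrite sec_var; exact: eqmMl.
Qed.

Lemma commz_kernel (Q : polyalg k X -> Prop) :
    (forall f, P f -> ideal_gen Q (commz f)) ->
    (forall q, Q q -> exists2 f, I f & commz f = q) ->
  forall f, ideal_gen Q (commz f) <-> I f.
Proof.
move=> PQ QP f; split=> [|If].
  suff sub q : ideal_gen Q q -> I (sec q).
    by move=> /sub; apply: eqm_ideal; apply: eqm_sym.
  elim=> {q} [q /QP [g Ig <-]||p q _ Ip _ Iq|a q _ Iq|a q _ Iq].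
  - exact: eqm_ideal (secK g) Ig.
  - by rewrite sec0; apply: ideal_gen0.
  - by rewrite secD; apply: ideal_genD.
  - by apply: (eqm_ideal (secM _ _)); apply: ideal_genMl.
  - by apply: (eqm_ideal (secM _ _)); apply: ideal_genMr.
elim: If => {f} [f /PQ //||f g _ If _ Ig|a f _ If|a f _ If].
- by rewrite (raddf0 (@commz k X)); apply: ideal_gen0.
- by rewrite (raddfD (@commz k X)); exact: (ideal_genD If Ig).
- by rewrite (rmorphM (@commz k X)); exact: (ideal_genMl _ If).
- by rewrite (rmorphM (@commz k X)); exact: (ideal_genMr _ If).
Qed.

Lemma pvarX (x : X) d : exists2 m : {cmonom X},
  pvar k x ^+ d = << m >> & forall y : X, m y = (d * (x == y))%N.
Proof.
elim: d => [|d [m IHd Dm]].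
  by exists mone => [|y]; rewrite ?expr0 // cm1.
exists (mmul (ucm x) m) => [|y]; first by rewrite exprS IHd malgUM.
by rewrite cmM cmU Dm mulSn.
Qed.

Let commz_mono m : commz (mono m) = << m >>.
Proof.
rewrite rmorph_prod; under eq_bigr do rewrite rmorphXn /= commz_var.
have [m' -> Dm']: exists2 m' : {cmonom X},
    \prod_(x : X) pvar k x ^+ m x = << m' >>
    & forall y : X, m' y = (\sum_(x : X) m x * (x == y))%N.
  elim: (index_enum X) => [|x r [m1 IHr Dm1]].
    by exists mone => [|y]; rewrite big_nil ?cm1.
  have [m2 E2 Dm2] := pvarX x (m x).
  exists (mmul m2 m1) => [|y]; first by rewrite big_cons IHr E2 malgUM.
  by rewrite big_cons cmM Dm1 Dm2.
suff -> : m' = m by [].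
apply/eqP/cmP=> y; rewrite Dm' (bigD1 y) //= eqxx muln1.
by rewrite big1 ?addn0 // => x /negPf->; rewrite muln0.
Qed.

Lemma commz_onto p : exists f : freealg k X, p = commz f.
Proof.
exists (sec p); rewrite secE raddf_sum [LHS]monalgE /=.
by apply: eq_bigr => m _; rewrite linearZ /= commz_mono malgUZ.
Qed.

End Kernel.

Section TensAlg.
Variables (k : fieldType) (X : finType).

Fact tens_alg_linear : linear (@tens_alg k X).
Proof.
move=> c s t; rewrite /tens_alg scaler_sumr -big_split /=.
by apply: eq_bigr => p _; rewrite !ffunE scalerDl scalerA.
Qed.
HB.instance Definition _ :=
  GRing.isLinear.Build k (tens2 k X) (freealg k X) *:%R (@tens_alg k X)
    tens_alg_linear.

Lemma tens_alg_basis (x y : X) :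
  tens_alg (tens (basis_vec k x) (basis_vec k y)) = fvar k x * fvar k y.
Proof.
rewrite /tens_alg (bigD1 (x, y)) //= big1 => [|[x' y'] /= ne].
  by rewrite !ffunE !eqxx mulr1 scale1r addr0.
rewrite !ffunE; move: ne; rewrite xpair_eqE negb_and.
by case: eqP => _; case: eqP => _ //= _; rewrite ?(mul0r, mulr0) scale0r.
Qed.

Lemma tens_alg_basisB (a b c d : X) :
  tens_alg (tens (basis_vec k a) (basis_vec k b)
            - tens (basis_vec k c) (basis_vec k d))
  = fvar k a * fvar k b - fvar k c * fvar k d.
Proof. by rewrite (raddfB (@tens_alg k X)) /= !tens_alg_basis. Qed.

Lemma commz_varB (a b c d : X) :
  commz (fvar k a * fvar k b - fvar k c * fvar k d)
  = pvar k a * pvar k b - pvar k c * pvar k d.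
Proof.
have M (u v : X) : commz (fvar k u * fvar k v) = pvar k u * pvar k v.
  by rewrite (rmorphM (@commz k X)) /= !commz_var.
exact: etrans (raddfB _ _ _) (congr2 (fun f g => f - g) (M a b) (M c d)).
Qed.

Lemma pvarC (a b : X) : pvar k a * pvar k b = pvar k b * pvar k a.
Proof.
apply: etrans (esym (malgUM k _ _)) (etrans _ (malgUM k _ _)).
by rewrite mulmC.
Qed.

Lemma commz_commutator (a b : X) :
  commz (fvar k a * fvar k b - fvar k b * fvar k a) = 0.
Proof.
exact: etrans (commz_varB a b b a)
  (etrans (congr1 (fun f => f - _) (pvarC a b)) (subrr _)).
Qed.

Lemma quad_ideal_span (s : seq (tens2 k X)) (J : freealg k X -> Prop) :
    J 0 -> (forall f g, J f -> J g -> J (f + g)) ->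
    (forall c f, J f -> J (c *: f)) -> {in s, forall t, J (tens_alg t)} ->
  forall t, t \in <<s>>%VS -> J (tens_alg t).
Proof.
move=> J0 JD JZ Js t st; rewrite (coord_span (X := in_tuple s) st).
rewrite linear_sum /=; apply: big_ind => // i _; rewrite linearZ.
by apply: JZ; apply: Js; rewrite mem_nth.
Qed.

End TensAlg.

Section BinomialEdgePresentation.
Variables (k : fieldType) (n : nat) (E : rel 'I_n).
Local Notation X := (xyvar n).
Local Notation I :=
  (quad_ideal (fun t => t \in binomial_edge_relations k E)).

Lemma binomial_edge_commutator (a b : X) :
  I (fvar k a * fvar k b - fvar k b * fvar k a).
Proof.
apply: ideal_gen_in.
exists (tens (basis_vec k a) (basis_vec k b)
        - tens (basis_vec k b) (basis_vec k a)).
  apply: memv_span; rewrite mem_cat; apply/orP; left.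
  by apply/imageP; exists (a, b).
by rewrite tens_alg_basisB.
Qed.

Fact binomial_edge_kernel f : binomial_edge_ideal E (commz f) <-> I f.
Proof.
apply: commz_kernel => {f} [a b|_ [t It ->]|_ [i j Eij]].
- exact: binomial_edge_commutator.
- apply: (quad_ideal_span (J := fun f => binomial_edge_ideal E (commz f))) It.
  + by rewrite (raddf0 (@commz k X)); apply: ideal_gen0.
  + by move=> f g Jf Jg; rewrite (raddfD (@commz k X)); exact: (ideal_genD Jf Jg).
  + by move=> c f Jf; rewrite linearZ /= -mul_malgC; exact: (ideal_genMl _ Jf).
  move=> u; rewrite mem_cat => /orP[] /imageP[] [a b] /= Eab ->.
    by rewrite tens_alg_basisB commz_commutator; apply: ideal_gen0.
  rewrite tens_alg_basisB commz_varB.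
  by apply: ideal_gen_in; constructor.
exists (fvar k (inl i) * fvar k (inr j) - fvar k (inl j) * fvar k (inr i)).
  apply: ideal_gen_in.
  exists (tens (basis_vec k (inl i : X)) (basis_vec k (inr j : X))
          - tens (basis_vec k (inl j : X)) (basis_vec k (inr i : X))).
    apply: memv_span; rewrite mem_cat; apply/orP; right.
    by apply/imageP; exists (i, j).
  by rewrite tens_alg_basisB.
by rewrite commz_varB.
Qed.

Fact binomial_edge_onto p :
  exists f, binomial_edge_ideal E (p - commz (k := k) f).
Proof.
have [f ->] := commz_onto (k := k) p.
by exists f; rewrite subrr; apply: ideal_gen0.
Qed.

Definition binomial_edge_presentation :
    quadratic_presentation X (@binomial_edge_ideal k n E) :=
  @QuadPres k X _ _ (binomial_edge_relations k E)
    (GRing.LRMorphism.clone k _ _ _ (@commz k X) _)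
    binomial_edge_onto binomial_edge_kernel.

End BinomialEdgePresentation.

(* Main.v *)
Require Import Defs.
From HB Require Import structures.
From mathcomp Require Import all_boot all_order all_algebra.
From mathcomp Require Import finmap.
From mathcomp.multinomials Require Import monalg.
Set Implicit Arguments.
Unset Strict Implicit.
Unset Printing Implicit Defensive.
Import GRing.Theory.
Local Open Scope ring_scope.

(** The tensors [u_a (x) u_b], with [u_a] and [u_b] basis vectors, are indexed
by the pairs [(a, b)] of variables.  Up to sign, every spanning relation of
S / J_G is a difference of two such tensors: a commutator compares [(a, b)]
with [(b, a)], and the binomial of an edge {i, j} compares [(x_i, y_j)] with
[(x_j, y_i)].  A form [Phi] is therefore orthogonal to the relations exactly
when its coefficients are constant along two involutions of the set of pairs,
the exchange [swap] of the two components and the exchange [edge_flip] of the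
two indices across an edge ([orthP]).

These involutions commute and so define an action of Z/2 x Z/2 on the pairs.
Averaging over it ([orbit_sum_average]) identifies the quadratic elements with
invariant coefficients with the linear combinations of the sums [orbit_sum p]
of the four images of a monomial; it divides by 4, which characteristic zero
allows.  It remains to see that the orbit sums are the listed relations up to
nonzero scalars ([orbit_sum_dual], [dual_relation_orbit]).  The scalar is the
order of the stabilizer of the pair: 4 for x_i^2 and y_i^2, 2 for
x_i x_j + x_j x_i, for y_i y_j + y_j y_i and for x_i y_j + y_j x_i off the
edges, and 1 for the four-term relation of an edge. *)

Section IdealGen.

Lemma ideal_gen_sub (A : pzRingType) (P Q : A -> Prop) :
  (forall f, P f -> ideal_gen Q f) ->
  forall f, ideal_gen P f -> ideal_gen Q f.
Proof.
move=> PQ f; elim=> {f} [f /PQ //||f g _ If _ Ig|a f _ If|a f _ If].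
- exact: ideal_gen0.
- exact: ideal_genD.
- exact: ideal_genMl.
- exact: ideal_genMr.
Qed.

Lemma ideal_gen_scale (k : fieldType) (X : finType)
    (P : freealg k X -> Prop) c f :
  ideal_gen P f -> ideal_gen P (c *: f).
Proof. by rewrite -mul_malgC; apply: ideal_genMl. Qed.

Lemma ideal_gen_divn (k : fieldType) (X : finType)
    (P : freealg k X -> Prop) (m : nat) f :
  m%:R != 0 :> k -> ideal_gen P (f *+ m) -> ideal_gen P f.
Proof.
move=> m0 /(ideal_gen_scale m%:R^-1).
by rewrite -scaler_nat scalerA mulVf // scale1r.
Qed.

End IdealGen.

(** Reindexing by [s], by [t] or by their composite leaves the coefficients in
place, so each of the four summands contributes the same sum. *)
Lemma sum_average4 (k : fieldType) (V : lmodType k) (T : finType)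
    (c : T -> k) (F : T -> V) (s t : T -> T) :
    injective s -> injective t ->
    (forall i, c (s i) = c i) -> (forall i, c (t i) = c i) ->
  (\sum_i c i *: F i) *+ 4
  = \sum_i c i *: (F i + F (s i) + (F (t i) + F (s (t i)))).
Proof.
move=> s_inj t_inj cs ct.
have reindexF h : injective h -> (forall i, c (h i) = c i) ->
    \sum_i c i *: F (h i) = \sum_i c i *: F i.
  move=> h_inj ch; rewrite [RHS](reindex_inj h_inj) /=.
  by apply: eq_bigr => i _; rewrite ch.
under [RHS]eq_bigr do rewrite !scalerDr.
rewrite !big_split /= (reindexF s) // (reindexF t) //.
rewrite (reindexF _ (inj_comp s_inj t_inj)) => [|i]; last by rewrite /= cs ct.
by rewrite -!mulr2n -mulrnA.
Qed.

Section Pairing.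
Variables (k : fieldType) (X : finType).
Implicit Types (Phi s t : tens2 k X).

Definition basis_tens (p : X * X) : tens2 k X :=
  tens (basis_vec k p.1) (basis_vec k p.2).

Lemma basis_tensE p q : basis_tens p q = (q == p)%:R.
Proof.
by case: p q => a b [c d]; rewrite !ffunE /= -natrM mulnb xpair_eqE.
Qed.

Lemma pairing_basis Phi p : pairing Phi (basis_tens p) = Phi p.
Proof.
rewrite /pairing (bigD1 p) //= basis_tensE eqxx mulr1 big1 ?addr0 // => q.
by rewrite basis_tensE => /negPf ->; rewrite mulr0.
Qed.

Fact pairing_linear Phi : linear (pairing Phi : tens2 k X -> k^o).
Proof.
move=> c s t; rewrite /pairing scaler_sumr -big_split /=.
by apply: eq_bigr => p _; rewrite !ffunE mulrDr mulrCA.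
Qed.
HB.instance Definition _ Phi :=
  GRing.isLinear.Build k (tens2 k X) k^o *:%R (pairing Phi)
    (pairing_linear Phi).

Lemma pairing_basisB Phi p q :
  pairing Phi (basis_tens p - basis_tens q) = Phi p - Phi q.
Proof. by rewrite raddfB /= !pairing_basis. Qed.

Lemma orth_span (s : seq (tens2 k X)) Phi :
  orth <<s>>%VS Phi <-> {in s, forall t, pairing Phi t = 0}.
Proof.
split=> [oPhi t st|oPhi t st]; first by apply: oPhi; apply: memv_span.
rewrite (coord_span (X := in_tuple s) st) linear_sum big1 // => i _.
by rewrite linearZ /= oPhi ?mem_nth // scaler0.
Qed.

Definition var_mul (p : X * X) : freealg k X := fvar k p.1 * fvar k p.2.

(* The coefficients are read in [k] rather than in [k^o], so that the sum uses
   the scaling of the free algebra by [k]. *)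
Lemma tens_algE Phi : tens_alg Phi = \sum_p (Phi p : k) *: var_mul p.
Proof. by []. Qed.

End Pairing.

Section EdgeOrbits.
Variables (k : fieldType) (n : nat) (E : rel 'I_n).
Hypotheses (E_sym : symmetric E).
Local Notation X := (xyvar n).
Implicit Types (p : X * X) (Phi : tens2 k X).

Definition swap p : X * X := (p.2, p.1).

Definition edge_flip p : X * X :=
  match p with
  | (inl i, inr j) => if E i j then (inl j, inr i) else p
  | (inr j, inl i) => if E i j then (inr i, inl j) else p
  | _ => p
  end.

Lemma swapK : involutive swap. Proof. by case. Qed.

Lemma edge_flipK : involutive edge_flip.
Proof.
by move=> [[i|i] [j|j]] //=; case: ifP => Eij; rewrite /= ?Eij // E_sym Eij.
Qed.

Lemma swap_edge_flip p : swap (edge_flip p) = edge_flip (swap p).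
Proof. by case: p => [[i|i] [j|j]] //=; case: ifP. Qed.

Definition orbit_invariant Phi : Prop :=
  (forall p, Phi (swap p) = Phi p) /\ (forall p, Phi (edge_flip p) = Phi p).

(** Each spanning relation is a difference of two basis tensors, so pairing
with it compares two coefficients. *)
Lemma orthP Phi : orth (binomial_edge_relations k E) Phi <-> orbit_invariant Phi.
Proof.
split=> [/orth_span oPhi|[swapPhi flipPhi]].
  have swapPhi p : Phi (swap p) = Phi p.
    apply/esym/eqP; rewrite -subr_eq0 -pairing_basisB; apply/eqP/oPhi.
    by rewrite mem_cat; apply/orP; left; apply/imageP; exists p.
  have flipPhi i j : E i j -> Phi (inl j, inr i) = Phi (inl i, inr j).
    move=> Eij; apply/esym/eqP; rewrite -subr_eq0 -pairing_basisB.
    apply/eqP/oPhi; rewrite mem_cat; apply/orP; right.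
    by apply/imageP; exists (i, j).
  split=> // -[[i|i] [j|j]] //=; case: ifP => // Eij; first exact: flipPhi.
  (* The edge tensors have their x-component first; the other order is
     reached through the commutators. *)
  by rewrite -swapPhi -[RHS]swapPhi; apply: flipPhi.
apply/orth_span => t; rewrite mem_cat => /orP[] /imageP[] p Ep ->.
  by rewrite (pairing_basisB Phi p (swap p)) swapPhi subrr.
rewrite (pairing_basisB Phi (inl p.1, inr p.2) (inl p.2, inr p.1)).
by have := flipPhi (inl p.1, inr p.2); rewrite /= (Ep : E _ _) => ->; rewrite subrr.
Qed.

Definition orbit_tens p : tens2 k X :=
  basis_tens k p + basis_tens k (swap p)
  + (basis_tens k (edge_flip p) + basis_tens k (swap (edge_flip p))).

Definition orbit_sum p : freealg k X :=
  var_mul k p + var_mul k (swap p)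
  + (var_mul k (edge_flip p) + var_mul k (swap (edge_flip p))).

Lemma orbit_sum_fixed p : edge_flip p = p ->
  orbit_sum p = (var_mul k p + var_mul k (swap p)) *+ 2.
Proof. by rewrite /orbit_sum mulr2n => ->. Qed.

Lemma orbit_sum_edge i j : E i j ->
  orbit_sum (inl i, inr j)
  = fvar k (inl i) * fvar k (inr j) + fvar k (inr j) * fvar k (inl i)
    + fvar k (inl j) * fvar k (inr i) + fvar k (inr i) * fvar k (inl j).
Proof. by move=> Eij; rewrite /orbit_sum /edge_flip Eij [LHS]addrA. Qed.

Lemma orbit_sum_swap p : orbit_sum (swap p) = orbit_sum p.
Proof.
rewrite /orbit_sum -swap_edge_flip !swapK.
exact: congr2 (addrC _ _) (addrC _ _).
Qed.

Lemma tens_alg_orbit p : tens_alg (orbit_tens p) = orbit_sum p.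
Proof. by rewrite !(raddfD (@tens_alg k X)) /= !tens_alg_basis. Qed.

(** Applying either involution permutes the four terms, because the two
commute. *)
Lemma orbit_tens_invariant p : orbit_invariant (orbit_tens p).
Proof.
have orbitE q : orbit_tens p q
    = (q == p)%:R + (q == swap p)%:R
      + ((q == edge_flip p)%:R + (q == swap (edge_flip p))%:R).
  by rewrite ffunE [X in X + _]ffunE [X in _ + X]ffunE !basis_tensE.
have eqS q r : (swap q == r) = (q == swap r) by rewrite (inv_eq swapK).
have eqF q r : (edge_flip q == r) = (q == edge_flip r).
  by rewrite (inv_eq edge_flipK).
split=> q; rewrite !orbitE.
  by rewrite !eqS !swapK; congr (_ + _); rewrite addrC.
by rewrite !eqF edge_flipK swap_edge_flip edge_flipK -swap_edge_flip addrC.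
Qed.

Lemma orbit_sum_average Phi : orbit_invariant Phi ->
  tens_alg Phi *+ 4 = \sum_p (Phi p : k) *: orbit_sum p.
Proof.
move=> [swapPhi flipPhi]; rewrite tens_algE.
by apply: sum_average4 => //; [exact: inv_inj swapK | exact: inv_inj edge_flipK].
Qed.

Local Notation D := (ideal_gen (@dual_relation k n E)).

(** The edges matter only for the mixed pairs, and among these (y_i, x_j)
reduces to (x_j, y_i) by [orbit_sum_swap]; [edge_flip] fixes all the other
pairs, whose orbit sums are thus twice a symmetrized product. *)
Lemma orbit_sum_dual p : D (orbit_sum p).
Proof.
have half q : D (var_mul k q + var_mul k (swap q)) -> edge_flip q = q ->
    D (orbit_sum q).
  by move=> Dq /orbit_sum_fixed ->; rewrite mulr2n; exact: ideal_genD.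
have mixed i j : D (orbit_sum (inl i, inr j)).
  have [Eij|nEij] := boolP (E i j); last first.
    by apply: half; [apply/ideal_gen_in/Dual_nonedge | rewrite /= (negPf nEij)].
  by rewrite orbit_sum_edge //; apply/ideal_gen_in/Dual_edge.
case: p => [[i|i] [j|j]] //.
- apply: half => //; case: (ltngtP i j) => [ij|ji|/val_inj <-].
  + by rewrite addrC; apply/ideal_gen_in/Dual_xxC.
  + exact/ideal_gen_in/Dual_xxC.
  + by apply: ideal_genD; apply/ideal_gen_in/Dual_xx.
- by rewrite -orbit_sum_swap; exact: mixed.
apply: half => //; case: (ltngtP i j) => [ij|ji|/val_inj <-].
- by rewrite addrC; apply/ideal_gen_in/Dual_yyC.
- exact/ideal_gen_in/Dual_yyC.
- by apply: ideal_genD; apply/ideal_gen_in/Dual_yy.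
Qed.

(** The multiplicity [m] accounts for the repetitions among the four images
of [p]: a square is met four times, a relation with two terms twice. *)
Lemma dual_relation_orbit f : dual_relation E f ->
  exists p, exists2 m, (0 < m)%N & orbit_sum p = f *+ m.
Proof.
case=> [i|i|i j _|i j _|i j nEij|i j Eij].
- exists (inl i, inl i), 4; first by [].
  by rewrite orbit_sum_fixed // -mulr2n -mulrnA.
- exists (inr i, inr i), 4; first by [].
  by rewrite orbit_sum_fixed // -mulr2n -mulrnA.
- by exists (inl i, inl j), 2; [|exact: orbit_sum_fixed].
- by exists (inr i, inr j), 2; [|exact: orbit_sum_fixed].
- exists (inl i, inr j), 2; first by [].
  by rewrite orbit_sum_fixed //= (negPf nEij).
- by exists (inl i, inr j), 1; [|exact: orbit_sum_edge].
Qed.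

End EdgeOrbits.

Theorem theorem4p1 (k : fieldType) (char0 : [pchar k] =i pred0)
    (n : nat) (E : rel 'I_n) (E_sym : symmetric E) (E_irr : irreflexive E) :
  forall f : freealg k (xyvar n),
    quadratic_dual_ideal (binomial_edge_presentation k E) f
      <-> ideal_gen (@dual_relation k n E) f.
Proof.
have natr_neq0 m : (0 < m)%N -> m%:R != 0 :> k.
  by move/pcharf0P: char0 => ->; rewrite lt0n.
move=> f; split; apply: ideal_gen_sub => {f} f.
  move=> [Phi /orthP invPhi ->]; apply: (ideal_gen_divn (natr_neq0 4 isT)).
  rewrite (orbit_sum_average E_sym invPhi).
  apply: big_ind => [||p _]; [exact: ideal_gen0|exact: ideal_genD|].
  exact/ideal_gen_scale/orbit_sum_dual.
move=> /dual_relation_orbit[p [m /natr_neq0 m0 orbit_f]].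
apply: (ideal_gen_divn m0); rewrite -orbit_f; apply: ideal_gen_in.
exists (orbit_tens k E p); last by rewrite tens_alg_orbit.
exact/orthP/orbit_tens_invariant.
Qed.
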